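(* If there is a $d\times n$ complex ETF, then there is a $d\times n$ complex ETF all of whose entries are algebraic numbers.
   Context: A $d\times n$ complex ETF (equiangular tight frame) is a matrix $\Phi=[\varphi_1\ \cdots\ \varphi_n]\in\mathbb{C}^{d\times n}$ with $\Phi\Phi^*=cI$ for some $c>0$, whose columns are equal-norm nonzero vectors spanning equiangular lines: there is $b\in[0,1)$ such that the unit-norm rescalings $\psi_j$ of $\varphi_j$ satisfy $|\langle\psi_i,\psi_j\rangle|^2=b$ for all $i\ne j$. An algebraic number is a complex zero of a nonzero polynomial with rational coefficients. *)

(* Defs.v *)
From mathcomp Require Import all_boot all_order all_algebra.
From mathcomp Require Import reals complex.

Set Implicit Arguments.
Unset Strict Implicit.
Unset Printing Implicit Defensive.

Import Order.TTheory GRing.Theory Num.Theory.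
Local Open Scope ring_scope.
Local Open Scope sesquilinear_scope.

(* Vectors are transposed into rows because [dotmx] is the Hermitian inner
   product of row vectors: [dotmx u v] is the sum of the [u_k * conj v_k]. *)
Definition colvec (C : numClosedFieldType) (d n : nat) (Phi : 'M[C]_(d, n))
  (j : 'I_n) : 'rV[C]_d := (col j Phi)^T.

Definition vnorm (C : numClosedFieldType) (d : nat) (v : 'rV[C]_d) : C :=
  sqrtC (dotmx v v).

Definition normalize (C : numClosedFieldType) (d : nat) (v : 'rV[C]_d) :
  'rV[C]_d := (vnorm v)^-1 *: v.

(* The scalars [b] and [c] below are real, although they have type [C]: the
   order of a [numClosedFieldType] only compares numbers with the same imaginary
   part, so that [0 < c] and [0 <= b] imply that [c] and [b] are real. *)
Definition tight_frame (C : numClosedFieldType) (d n : nat)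
  (Phi : 'M[C]_(d, n)) : Prop :=
  exists2 c : C, 0 < c & Phi *m Phi^t* = c%:M.

Definition equal_norm (C : numClosedFieldType) (d n : nat)
  (Phi : 'M[C]_(d, n)) : Prop :=
  forall i j : 'I_n, vnorm (colvec Phi i) = vnorm (colvec Phi j).

Definition equiangular (C : numClosedFieldType) (d n : nat)
  (Phi : 'M[C]_(d, n)) : Prop :=
  exists2 b : C, 0 <= b < 1 &
    forall i j : 'I_n, i != j ->
      `|dotmx (normalize (colvec Phi i)) (normalize (colvec Phi j))| ^+ 2 = b.

Definition is_ETF (C : numClosedFieldType) (d n : nat)
  (Phi : 'M[C]_(d, n)) : Prop :=
  [/\ tight_frame Phi,
      forall j : 'I_n, colvec Phi j != 0,
      equal_norm Phi
    & equiangular Phi].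

Definition algebraic_number (C : numClosedFieldType) (z : C) : Prop :=
  algebraicOver (ratr : rat -> C) z.

(* Main.v *)
(* A d x n ETF is a real point x of a system of polynomial equations and strict
   or weak inequalities over rat, in the real and imaginary parts of the entries
   and the constants c (tightness), s (squared norm) and b (angle). Such a point
   can be moved to a real algebraic one, one coordinate at a time: a ring
   morphism phi : A -> R is approximable when, on every finite subset of A, it is
   approximated by a morphism with algebraic values that keeps the zeros of phi.
   This property passes from phi to its extension {poly A} -> R sending 'X to y.
   If no polynomial with coefficients in A has y as a nontrivial root, a zero at
   y is a zero of all coefficients, and a rational number near y replaces y.
   Otherwise y is a simple root of an annihilator m of minimal degree; m keeps
   its sign change when phi is perturbed, so the perturbed m has a root z near
   y, and the pseudo-remainder by m of a polynomial vanishing at (phi, y) has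
   all its coefficients in the kernel of phi, so that it still vanishes at z. *)
Require Import Defs.
From mathcomp Require Import all_boot all_order all_algebra.
From mathcomp Require Import boolp reals complex polyrcf.
From mathcomp Require Import ring lra.

Set Implicit Arguments.
Unset Strict Implicit.
Unset Printing Implicit Defensive.

Import Order.TTheory GRing.Theory Num.Theory.
Local Open Scope ring_scope.

(** * Stability of signs and continuity of polynomial evaluation *)

Lemma sgr_close (R : realDomainType) (x y : R) :
  `|x - y| < `|y| -> Num.sg x = Num.sg y.
Proof.
case: (ltgtP y 0) => [y0|y0|->]; last by rewrite normr0 normr_lt0.
- rewrite (ltr0_norm y0) ltr_norml => /andP[_ ?].
  by rewrite !ltr0_sg //; lra.
- rewrite (gtr0_norm y0) ltr_norml => /andP[? _].
  by rewrite !gtr0_sg //; lra.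
Qed.

Lemma uniform_pos (R : realDomainType) (T : eqType) (s : seq T)
    (P : T -> R -> Prop) :
    (forall x d d', d' <= d -> P x d -> P x d') ->
    (forall x, x \in s -> exists2 d, 0 < d & P x d) ->
  exists2 d, 0 < d & forall x, x \in s -> P x d.
Proof.
move=> Pdec; elim: s => [|x s IHs] Ps; first by exists 1.
have [|d d0 Pd] := IHs; first by move=> z zs; apply: Ps; rewrite inE zs orbT.
have [|e e0 Pe] := Ps x; first by rewrite inE eqxx.
exists (Num.min d e) => [|z]; first by rewrite lt_min d0.
rewrite inE => /predU1P[->|zs]; first by apply: Pdec Pe; rewrite ge_min lexx orbT.
by apply: Pdec (Pd _ zs); rewrite ge_min lexx.
Qed.

(** Joint continuity in the coefficients and the point, by induction along Horner's scheme. As [A]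
    carries no topology, [psi] is compared with [phi] only on the coefficients of [p]. *)
Lemma horner_close (R : realFieldType) (A : comNzRingType)
    (phi : {rmorphism A -> R}) (p : {poly A}) (y e : R) :
  0 < e ->
  exists2 d, 0 < d &
    forall (psi : {rmorphism A -> R}) (z : R),
      (forall c, c \in (p : seq A) -> `|psi c - phi c| < d) ->
      `|z - y| < d ->
      `|(map_poly psi p).[z] - (map_poly phi p).[y]| < e.
Proof.
move=> e0.
(* Coefficients beyond the size are [0], so the bound extends to every index; in that form it passes
   from [p * 'X + c] to [p]. *)
have coefs (d : R) (psi : {rmorphism A -> R}) (q : {poly A}) : 0 < d ->
    (forall c, c \in (q : seq A) -> `|psi c - phi c| < d) ->
    forall i, `|psi q`_i - phi q`_i| < d.
  move=> d0 qd i; case: (ltnP i (size q)) => iq; first exact/qd/mem_nth.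
  by rewrite nth_default // !rmorph0 subrr normr0.
suff [d d0 Pd] : exists2 d, 0 < d &
    forall (psi : {rmorphism A -> R}) (z : R),
      (forall i, `|psi p`_i - phi p`_i| < d) ->
      `|z - y| < d ->
      `|(map_poly psi p).[z] - (map_poly phi p).[y]| < e.
  by exists d => // psi z /(coefs _ _ _ d0) /Pd; apply.
elim/poly_ind: p e e0 => [|p c IHp] e e0.
  by exists 1 => // psi z _ _; rewrite !rmorph0 !horner0 subrr normr0.
set v := (map_poly phi p).[y].
(* The perturbed value [w] of [p] will satisfy [|w| <= |v| + 1], by the [1] in the minimum below;
   this [k] then bounds both [w * (z - y)] and [(w - v) * y] by [e / 3]. *)
pose k := e / 3 / (`|v| + `|y| + 1).
have k0 : 0 < k by rewrite !divr_gt0 // ltr_wpDl // addr_ge0.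
have [d d0 Pd] := IHp (Num.min 1 k) ltac:(by rewrite lt_min ltr01).
exists (Num.min d (Num.min (e / 3) k)).
  by rewrite !lt_min d0 k0 divr_gt0.
move=> psi z cd; rewrite !lt_min => /and3P[zd ze zk].
have {}Pd : `|(map_poly psi p).[z] - v| < Num.min 1 k.
  apply: Pd => // i; have := cd i.+1.
  by rewrite coefD coefMX coefC /= addr0 lt_min => /andP[].
have {cd} : `|psi c - phi c| < e / 3.
  have := cd 0; rewrite coefD coefMX coefC /= add0r.
  by rewrite !lt_min => /and3P[].
rewrite !rmorphD !rmorphM /= !map_polyX !map_polyC !hornerE /= -/v.
move: Pd; set w := _.[z]; rewrite lt_min => /andP[w1 wk] cc.
have -> : w * z + psi c - (v * y + phi c) =
  (w * (z - y)) + ((w - v) * y) + (psi c - phi c) by ring.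
have wv : `|w| <= `|v| + 1.
  by rewrite -[w](subrK v) addrC (le_trans (ler_normD _ _)) // lerD2l ltW.
have kE : k * (`|v| + `|y| + 1) = e / 3.
  by rewrite /k divfK // gt_eqF // ltr_wpDl // addr_ge0.
have h1 : `|w * (z - y)| <= e / 3.
  rewrite normrM -kE mulrC ler_pM //; first exact: ltW.
  by apply: (le_trans wv); rewrite addrAC lerDl.
have h2 : `|(w - v) * y| <= e / 3.
  rewrite normrM -kE ler_pM //; first exact: ltW.
  by rewrite addrAC lerDr addr_ge0.
have := ler_normD (w * (z - y) + (w - v) * y) (psi c - phi c).
have := ler_normD (w * (z - y)) ((w - v) * y).
lra.
Qed.

(** * Algebraic approximation of morphisms, and adjunction of one real number *)

Definition algebraic_real (R : realType) (x : R) := algebraicOver (ratr : rat -> R) x.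

(** [A] is meant to be a polynomial ring over [rat] and [phi] the evaluation at a real point: [fs]
    lists the polynomials of a system, and [psi] evaluates them at an algebraic point. *)
Definition approximable (R : realType) (A : comNzRingType)
    (phi : {rmorphism A -> R}) : Prop :=
  forall (fs : seq A) (e : R), 0 < e ->
  exists2 psi : {rmorphism A -> R},
    forall a, algebraic_real (psi a) &
    forall f, f \in fs -> `|psi f - phi f| < e /\ (phi f = 0 -> psi f = 0).

Definition adjoin (R : realType) (A : comNzRingType)
    (phi : {rmorphism A -> R}) (y : R) : {rmorphism {poly A} -> R} :=
  horner_eval y \o map_poly phi.

Lemma algebraic_adjoin (R : realType) (A : comNzRingType)
    (psi : {rmorphism A -> R}) (z : R) :
    (forall a, algebraic_real (psi a)) -> algebraic_real z ->
  forall p, algebraic_real (adjoin psi z p).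
Proof.
move=> psialg zalg; elim/poly_ind => [|p c IHp].
  by rewrite rmorph0; apply: algebraic0.
rewrite rmorphD rmorphM; apply: algebraic_add; last first.
  by rewrite /adjoin /= map_polyC /horner_eval hornerC; apply: psialg.
apply: algebraic_mul => //.
by rewrite /adjoin /= map_polyX /horner_eval hornerX.
Qed.

Lemma algebraic_real_root (R : realType) (p : {poly R}) (z : R) :
    p != 0 -> root p z -> (forall i, algebraic_real p`_i) -> algebraic_real z.
Proof.
move=> p0 pz palg; apply/integral_algebraic; apply: integral_root p0 pz _.
by move=> _ /(nthP 0)[i _ <-]; apply/integral_algebraic/palg.
Qed.

Lemma simple_root_sign_change (R : realFieldType) (p : {poly R}) (y e : R) :
    0 < e -> root p y -> ~~ root p^`() y ->
  exists2 d, 0 < d < e & p.[y - d] * p.[y + d] < 0.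
Proof.
move=> e0 /factor_theorem[q ->]; rewrite derivM derivXsubC mulr1 rootE.
rewrite !hornerE subrr mulr0 add0r => qy.
(* The morphism is the identity of [R]: only the point moves. *)
have [d d0 qd] := @horner_close R R idfun q y `|q.[y]| ltac:(by rewrite normr_gt0).
have {}qd z : `|z - y| < d -> Num.sg q.[z] = Num.sg q.[y].
  move=> zd; apply: sgr_close; have := qd idfun z.
  rewrite map_poly_id //; apply=> // c _; by rewrite subrr normr0.
pose h := Num.min d e / 2.
have h0 : 0 < h by rewrite divr_gt0 // lt_min d0.
have hm : h < Num.min d e by rewrite /h; have: 0 < Num.min d e by [rewrite lt_min d0]; lra.
move: hm; rewrite lt_min => /andP[hd he].
exists h; first by rewrite h0.
have qm : Num.sg q.[y - h] = Num.sg q.[y].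
  by apply: qd; rewrite addrAC subrr sub0r normrN gtr0_norm.
have qp : Num.sg q.[y + h] = Num.sg q.[y].
  by apply: qd; rewrite addrAC subrr add0r gtr0_norm.
rewrite -sgr_cp0 !hornerE !sgrM qm qp.
have -> : y - h - y = - h by ring.
have -> : y + h - y = h by ring.
by rewrite sgrN (gtr0_sg h0) mulr1 mulrN1 mulNr -expr2 sqr_sg qy.
Qed.

Lemma approximable_rat (R : realType) :
  approximable (ratr : {rmorphism rat -> R}).
Proof.
move=> fs e e0; exists ratr => [a|f _]; first exact: algebraic_id.
by rewrite subrr normr0.
Qed.

Lemma adjoin_close (R : realType) (A : comNzRingType)
    (phi : {rmorphism A -> R}) (y e : R) (fs : seq {poly A}) : 0 < e ->
  exists2 d, 0 < d &
    forall (psi : {rmorphism A -> R}) (z : R),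
      (forall f c, f \in fs -> c \in (f : seq A) -> `|psi c - phi c| < d) ->
      `|z - y| < d ->
      forall f, f \in fs -> `|adjoin psi z f - adjoin phi y f| < e.
Proof.
move=> e0; pose P (f : {poly A}) d := forall (psi : {rmorphism A -> R}) z,
  (forall c, c \in (f : seq A) -> `|psi c - phi c| < d) ->
  `|z - y| < d -> `|adjoin psi z f - adjoin phi y f| < e.
have [f d d' d'd Pfd psi z cd' zd'|f _|d d0 Pd] := @uniform_pos R _ fs P.
- by apply: Pfd => [c /cd' ccd'|]; apply: lt_le_trans d'd.
- exact: horner_close.
- by exists d => // psi z cd zd f ffs; apply: Pd => // c; apply: cd.
Qed.

Lemma map_poly_eq0_coefs (A R S : nzRingType)
    (phi : {rmorphism A -> R}) (psi : {rmorphism A -> S}) (p : {poly A}) :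
    (forall c, c \in (p : seq A) -> phi c = 0 -> psi c = 0) ->
  map_poly phi p = 0 -> map_poly psi p = 0.
Proof.
move=> pc /polyP p0; apply/polyP => i; rewrite coef0 coef_map.
case: (ltnP i (size p)) => ip; last by rewrite nth_default // raddf0.
by apply: pc; [exact: mem_nth | rewrite -coef_map p0 coef0].
Qed.

Lemma approximable_adjoin_transcendental (R : realType) (A : comNzRingType)
    (phi : {rmorphism A -> R}) (y : R) :
    approximable phi ->
    (forall m, root (map_poly phi m) y -> map_poly phi m = 0) ->
  approximable (adjoin phi y).
Proof.
move=> phi_appr y_tr fs e e0.
have [d d0 Pd] := adjoin_close phi y fs e0.
have [q /andP[yq qy]] : exists q : rat, ratr q \in `]y - d, y + d[.
  by apply: rat_in_itvoo; lra.
(* The approximation is requested on all coefficients of [fs]: closeness there controls the values,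
   and the zeros kept there are those that [y_tr] produces. *)
have [psi psi_alg psi_close] := phi_appr (flatten (map polyseq fs)) d d0.
have in_coefs f c : f \in fs -> c \in (f : seq A) ->
    c \in flatten (map polyseq fs).
  by move=> ffs cf; apply/flatten_mapP; exists f.
exists (adjoin psi (ratr q)).
  by apply: algebraic_adjoin => //; apply: algebraic_id.
move=> f ffs; split.
  apply: Pd => // [g c gfs cg|]; first by have [] := psi_close _ (in_coefs g c gfs cg).
  by move: yq qy; rewrite !bnd_simp ltr_norml; lra.
move=> /eqP/y_tr/(map_poly_eq0_coefs (psi := psi)) fpsi.
rewrite /adjoin /= fpsi /horner_eval ?horner0 // => c cf.
by have [] := psi_close _ (in_coefs f c ffs cf).
Qed.

(** The size is minimized over [A], not over [R]: a leading coefficient killed by [phi] could be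
    dropped, giving a shorter annihilator. The derivative is shorter too, so if it vanished at [y]
    its image would be [0], which characteristic 0 excludes. *)
Lemma minimal_annihilator (R : realType) (A : comNzRingType)
    (phi : {rmorphism A -> R}) (y : R) (p : {poly A}) :
    root (map_poly phi p) y -> map_poly phi p != 0 ->
  exists m : {poly A}, [/\ root (map_poly phi m) y, phi (lead_coef m) != 0,
    ~~ root (map_poly phi m)^`() y &
    forall r : {poly A}, (size r < size m)%N -> root (map_poly phi r) y ->
      map_poly phi r = 0].
Proof.
move=> py p0.
pose good n := `[< exists m : {poly A},
  [/\ size m = n, root (map_poly phi m) y & map_poly phi m != 0] >].
have ex_good : exists n, good n by exists (size p); apply/asboolP; exists p.
case: (ex_minnP ex_good) => _ /asboolP[m [<- my m0]] min_m.
have {}min_m (r : {poly A}) : (size r < size m)%N -> root (map_poly phi r) y ->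
    map_poly phi r = 0.
  move=> rm ry; apply/eqP/negPn/negP => r0.
  suff /min_m : good (size r) by rewrite leqNgt rm.
  by apply/asboolP; exists r.
have sm : (0 < size m)%N.
  by rewrite size_poly_gt0; apply: contra_neq m0 => ->; rewrite rmorph0.
exists m; split=> //.
  apply: contra_neq m0 => lm0.
  have mE : map_poly phi m = map_poly phi (\poly_(i < (size m).-1) m`_i).
    apply/polyP => i; rewrite !coef_map coef_poly.
    case: ltngtP => // [mi|->]; last exact: etrans lm0 (esym (rmorph0 phi)).
    by rewrite nth_default // -(prednK sm).
  rewrite mE; apply: min_m; last by rewrite -mE.
  by rewrite (leq_ltn_trans (size_poly _ _)) // prednK.
rewrite deriv_map; apply/negP => /min_m dm0.
have {}dm0 : (map_poly phi m)^`() = 0.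
  rewrite deriv_map dm0 // lt_size_deriv //.
  by rewrite -size_poly_gt0.
have m1 : (1 < size (map_poly phi m))%N := root_size_gt1 m0 my.
(* The coefficient of the derivative at this index is the leading coefficient of the image of [m]
   times its degree, which is positive. *)
have : (map_poly phi m)^`()`_(size (map_poly phi m)).-2 = 0 by rewrite dm0 coef0.
case: (size _) (lead_coefE (map_poly phi m)) m1 => [|[|k]] //= lE _.
rewrite coef_deriv -lE => /eqP.
by rewrite mulrn_eq0 /= lead_coef_eq0 (negPf m0).
Qed.

Lemma approximable_adjoin_algebraic (R : realType) (A : comNzRingType)
    (phi : {rmorphism A -> R}) (y : R) (p : {poly A}) :
    approximable phi -> root (map_poly phi p) y -> map_poly phi p != 0 ->
  approximable (adjoin phi y).
Proof.
move=> phi_appr py p0 fs e e0.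
have [m [my lm0 m'y min_m]] := minimal_annihilator py p0.
have [d1 d10 Pd1] := adjoin_close phi y fs e0.
have [h /andP[h0 hd1] mh] := simple_root_sign_change d10 my m'y.
have close_at (x : R) : (map_poly phi m).[x] != 0 -> exists2 d, 0 < d &
    forall psi : {rmorphism A -> R},
      (forall c, c \in (m : seq A) -> `|psi c - phi c| < d) ->
      Num.sg (map_poly psi m).[x] = Num.sg (map_poly phi m).[x].
  rewrite -normr_gt0 => mx0; have [d d0 Pd] := horner_close phi m x mx0.
  exists d => // psi cd; apply: sgr_close; apply: Pd => //.
  by rewrite subrr normr0.
have [|d2 d20 Pd2] := close_at (y - h).
  by apply: contraTneq mh => ->; rewrite mul0r ltxx.
have [|d3 d30 Pd3] := close_at (y + h).
  by apply: contraTneq mh => ->; rewrite mulr0 ltxx.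
(* [d1] controls the values of [fs], the leading coefficient must stay nonzero under [psi], and
   [d2], [d3] preserve the signs at [y - h] and [y + h]. *)
pose d := Num.min (Num.min d1 `|phi (lead_coef m)|) (Num.min d2 d3).
have d0 : 0 < d by rewrite !lt_min d10 d20 d30 normr_gt0 lm0.
pose rem f := (Pdiv.CommonRing.redivp f m).2.
(* The coefficients of [m] serve the sign change, those of [fs] the closeness, those of the
   remainders the preservation of zeros. *)
pose cs := flatten (map polyseq (m :: fs ++ map rem fs)).
have in_cs (f : {poly A}) c :
    f \in m :: fs ++ map rem fs -> c \in (f : seq A) -> c \in cs.
  by move=> ffs cf; apply/flatten_mapP; exists f.
have [psi psi_alg psi_close] := phi_appr cs d d0.
have m_close c : c \in (m : seq A) -> `|psi c - phi c| < d.
  by move=> cm; have [|] := psi_close c; first by apply: in_cs cm; rewrite inE eqxx.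
have mn0 : m != 0 by apply: contra_neq lm0 => ->; rewrite lead_coef0 rmorph0.
have lpsi : psi (lead_coef m) != 0.
  have /m_close : lead_coef m \in (m : seq A).
    by rewrite lead_coefE mem_nth // prednK ?size_poly_gt0.
  rewrite !lt_min => /andP[/andP[_ /sgr_close/eqP]] sgE _.
  by rewrite -sgr_eq0 (eqP sgE) sgr_eq0.
have : (map_poly psi m).[y - h] * (map_poly psi m).[y + h] < 0.
  rewrite -sgr_cp0 sgrM Pd2 ?Pd3 -?sgrM ?sgr_cp0 // => c /m_close;
    by rewrite !lt_min => /andP[_ /andP[]].
move=> /poly_ivtoo[|z /andP[yz zy] mz]; first by lra.
rewrite !bnd_simp in yz zy.
have psim0 : map_poly psi m != 0.
  apply: contra_neq lpsi => /polyP/(_ (size m).-1).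
  by rewrite coef_map coef0 -lead_coefE.
exists (adjoin psi z).
  apply: algebraic_adjoin => //; apply: (algebraic_real_root psim0 mz) => i.
  by rewrite coef_map; apply: psi_alg.
move=> f ffs; split.
  apply: Pd1 => // [g c gfs cg|]; last by rewrite ltr_norml; lra.
  have [|cd _] := psi_close c.
    by apply: in_cs cg; rewrite inE mem_cat gfs orbT.
  by apply: lt_le_trans cd _; rewrite !ge_min lexx.
move=> fy.
have : rem f \in m :: fs ++ map rem fs by rewrite inE mem_cat map_f ?orbT.
rewrite /rem; case: Pdiv.CommonRing.comm_redivpP => k q r mE /(_ mn0) /= rm r_in.
(* Division in the ring [A] costs a power of the leading coefficient of [m]; its image under [psi]
   is nonzero and is cancelled at the end. *)
have {}mE : f * (lead_coef m ^+ k)%:P = q * m + r by apply: mE; apply: mulrC.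
have divE (chi : {rmorphism A -> R}) x : root (map_poly chi m) x ->
    adjoin chi x f * chi (lead_coef m) ^+ k = adjoin chi x r.
  move=> /eqP mx; have := congr1 (adjoin chi x) mE.
  rewrite rmorphM rmorphD rmorphM /=.
  by rewrite /adjoin /= /horner_eval mx mulr0 add0r map_polyC hornerC -(rmorphXn chi).
have r0 : map_poly phi r = 0.
  apply: min_m => //; rewrite rootE.
  by have := divE phi y my; rewrite fy mul0r /adjoin /= /horner_eval => <-.
have rpsi : map_poly psi r = 0.
  apply: map_poly_eq0_coefs r0 => c cr.
  by have [] := psi_close c (in_cs _ _ r_in cr).
apply: (mulIf (expf_neq0 k lpsi)); rewrite divE // mul0r.
by rewrite /adjoin /= /horner_eval rpsi horner0.
Qed.

Lemma approximable_adjoinP (R : realType) (A : comNzRingType)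
    (phi : {rmorphism A -> R}) (y : R) :
  approximable phi -> approximable (adjoin phi y).
Proof.
move=> phi_appr.
have [[p [py p0]]|y_tr] := pselect
    (exists p, root (map_poly phi p) y /\ map_poly phi p != 0).
  exact: approximable_adjoin_algebraic py p0.
apply: approximable_adjoin_transcendental => // m my.
by apply/eqP/negPn/negP => m0; apply: y_tr; exists m.
Qed.

(** [A] is an iterated polynomial ring over [rat], with one variable for each entry of [xs], and
    [phi] evaluates each variable at its entry. *)
Lemma approximable_values (R : realType) (xs : seq R) :
  exists (A : comNzRingType) (phi : {rmorphism A -> R}),
    approximable phi /\ forall x, x \in xs -> exists a, phi a = x.
Proof.
elim: xs => [|y xs [A [phi [phi_appr phi_xs]]]].
  by exists rat, ratr; split=> //; apply: approximable_rat.
exists {poly A}, (adjoin phi y); split; first exact: approximable_adjoinP.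
move=> x; rewrite inE => /predU1P[->|/phi_xs[a <-]].
  by exists 'X; rewrite /adjoin /= map_polyX /horner_eval hornerX.
by exists a%:P; rewrite /adjoin /= map_polyC /horner_eval hornerC.
Qed.

(** Zeros are kept by approximability; the other signs are kept once the error is below every
    nonzero [|phi f|]. *)
Lemma approximable_sgr (R : realType) (A : comNzRingType)
    (phi : {rmorphism A -> R}) (fs : seq A) : approximable phi ->
  exists2 psi : {rmorphism A -> R},
    forall a, algebraic_real (psi a) &
    forall f, f \in fs -> Num.sg (psi f) = Num.sg (phi f).
Proof.
move=> phi_appr.
have [f d d' d'd dphi /dphi|f _|d d0 dP] := @uniform_pos R _ fs
  (fun f d => phi f != 0 -> d <= `|phi f|); first exact: le_trans.
- have [f0|f0] := eqVneq (phi f) 0; first by exists 1.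
  by exists `|phi f| => //; rewrite normr_gt0.
have [psi psi_alg psiP] := phi_appr fs d d0.
exists psi => // f ffs; have [fd f0] := psiP f ffs.
have [pf0|pf0] := eqVneq (phi f) 0; first by rewrite pf0 f0.
by apply: sgr_close; apply: lt_le_trans fd (dP f ffs pf0).
Qed.

(** * Complex frames as pairs of real matrices *)

Section ComplexMatrices.

Local Open Scope sesquilinear_scope.
Local Open Scope complex_scope.

Definition complex_mx (R : rcfType) (m p : nat) (X Y : 'M[R]_(m, p)) :
  'M[R[i]]_(m, p) := \matrix_(i, j) (X i j +i* Y i j).

(** With [gram_im], the two parts of [(X + iY)(X + iY)^*]. They are defined over any commutative
    ring so that they can be formed in [A] before a morphism is applied. *)
Definition gram_re (A : comNzRingType) (m p : nat) (X Y : 'M[A]_(m, p)) :=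
  X *m X^T + Y *m Y^T.

Definition gram_im (A : comNzRingType) (m p : nat) (X Y : 'M[A]_(m, p)) :=
  Y *m X^T - X *m Y^T.

Lemma sum_complex (R : rcfType) (I : finType) (F G : I -> R) :
  \sum_i (F i +i* G i) = (\sum_i F i) +i* (\sum_i G i).
Proof. by elim/big_rec3: _ => // i x y z _ ->. Qed.

Lemma complex_mx_eq (R : rcfType) (m p : nat) (X Y Z W : 'M[R]_(m, p)) :
  complex_mx X Y = complex_mx Z W <-> X = Z /\ Y = W.
Proof.
split=> [/matrixP XYZW|[-> ->] //].
by split; apply/matrixP => i j; have := XYZW i j; rewrite !mxE => -[].
Qed.

Lemma complex_mx_gram (R : rcfType) (m p : nat) (X Y : 'M[R]_(m, p)) :
  complex_mx X Y *m (complex_mx X Y)^t* =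
  complex_mx (gram_re X Y) (gram_im X Y).
Proof.
apply/matrixP => i j; rewrite !mxE -!big_split -sumrN -big_split -sum_complex.
apply: eq_bigr => k _; rewrite !mxE.
by apply/eqP; rewrite eq_complex /=; apply/andP; split; apply/eqP; ring.
Qed.

Lemma trmx_complex_mx (R : rcfType) (m p : nat) (X Y : 'M[R]_(m, p)) :
  (complex_mx X Y)^T = complex_mx X^T Y^T.
Proof. by apply/matrixP => i j; rewrite !mxE. Qed.

Lemma complex_mxE (R : rcfType) (m p : nat) (Phi : 'M[R[i]]_(m, p)) :
  Phi = complex_mx (map_mx (@complex.Re R) Phi) (map_mx (@complex.Im R) Phi).
Proof. by apply/matrixP => i j; rewrite !mxE; case: (Phi i j). Qed.

(** Inner products of columns become entries of a product of the same shape as [Phi *m Phi^t*], so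
    one Gram formula serves both. *)
Lemma dotmx_colvec (C : numClosedFieldType) (d n : nat) (Phi : 'M[C]_(d, n))
    (i j : 'I_n) :
  dotmx (colvec Phi i) (colvec Phi j) = (Phi^T *m Phi^T^t* ) i j.
Proof.
rewrite dotmxE !mxE; by apply: eq_bigr => k _; rewrite /colvec !mxE.
Qed.

Lemma dotmx_normalize (C : numClosedFieldType) (d : nat) (u v : 'rV[C]_d) :
  `|dotmx (normalize u) (normalize v)| ^+ 2 =
  `|dotmx u v| ^+ 2 / (dotmx u u * dotmx v v).
Proof.
have norm2 (w : 'rV[C]_d) : `|(vnorm w)^-1| ^+ 2 = (dotmx w w)^-1.
  rewrite ger0_norm ?invr_ge0 ?sqrtC_ge0 ?dnorm_ge0 //.
  by rewrite exprVn sqrtCK.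
rewrite /normalize linearZl_LR linearZr_LR /= !normrM !exprMn norm_conjC !norm2.
by rewrite invfM mulrA mulrC.
Qed.

(** Square roots and quotients are cleared: what remains is polynomial in the real and imaginary
    parts of the entries and of the constants. *)
Lemma is_ETF_gram (C : numClosedFieldType) (d n : nat) (Phi : 'M[C]_(d, n)) :
  is_ETF Phi <->
  exists c s b : C,
    [/\ [/\ 0 < c, 0 < s & 0 <= b < 1], Phi *m Phi^t* = c%:M,
        forall i, dotmx (colvec Phi i) (colvec Phi i) = s
      & forall i j, i != j ->
          `|dotmx (colvec Phi i) (colvec Phi j)| ^+ 2 = b * s ^+ 2].
Proof.
split=> [[[c c0 PhiE] nz eqn [b b01 angle]]|].
  have [s s0 sE] : exists2 s, 0 < s &
      forall i, dotmx (colvec Phi i) (colvec Phi i) = s.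
    (* Without columns there is no norm to read off, and [1] is an arbitrary positive choice of
       [s]. *)
    case: (pickP 'I_n) => [j _|no_j]; last by exists 1 => // i; have := no_j i.
    exists (dotmx (colvec Phi j) (colvec Phi j)); first exact: dotmx_is_dotmx.
    by move=> i; rewrite -[LHS]sqrtCK -[RHS]sqrtCK; congr (_ ^+ 2); apply: eqn.
  exists c, s, b; split=> // i j ij.
  rewrite -(angle i j ij) dotmx_normalize !sE -expr2 divfK //.
  by rewrite expf_neq0 // gt_eqF.
move=> [c [s [b [[c0 s0 b01] PhiE sE angle]]]]; split.
- by exists c.
- move=> j; apply/eqP => j0; have := sE j.
  by rewrite j0 linear0l => s00; rewrite -s00 ltxx in s0.
- by move=> i j; rewrite /vnorm !sE.
exists b => // i j ij; rewrite dotmx_normalize !sE angle // -expr2 mulfK //.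
by rewrite expf_neq0 // gt_eqF.
Qed.

(** The bound [b < 1] is written [0 < 1 - b] so that each condition is about the sign of one ring
    element. *)
Definition real_ETF (R : realDomainType) (d n : nat) (X Y : 'M[R]_(d, n))
    (c s b : R) : Prop :=
  [/\ [/\ 0 < c, 0 < s, 0 <= b & 0 < 1 - b],
      gram_re X Y = c%:M /\ gram_im X Y = 0,
      forall i, gram_re X^T Y^T i i = s
    & forall i j, i != j ->
        gram_re X^T Y^T i j ^+ 2 + gram_im X^T Y^T i j ^+ 2 = b * s ^+ 2].

Lemma is_ETF_complex_mx (R : rcfType) (d n : nat) (X Y : 'M[R]_(d, n)) :
  is_ETF (complex_mx X Y) <-> exists c s b, real_ETF X Y c s b.
Proof.
have dotE i j : dotmx (colvec (complex_mx X Y) i) (colvec (complex_mx X Y) j)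
    = gram_re X^T Y^T i j +i* gram_im X^T Y^T i j.
  by rewrite dotmx_colvec trmx_complex_mx complex_mx_gram mxE.
have im0 i : gram_im X^T Y^T i i = 0.
  rewrite !mxE -sumrN -big_split big1 // => k _ /=.
  by rewrite !mxE mulrC subrr.
have scalarE (c : R) : (c%:C)%:M = complex_mx c%:M 0 :> 'M_d.
  by apply/matrixP => i j; rewrite !mxE; case: (i == j).
rewrite is_ETF_gram complex_mx_gram; split.
  move=> [[c c'] [[s s'] [[b b'] [[]]]]].
  (* The order of [R[i]] forces the imaginary parts of [c], [s] and [b] to vanish, which gives real
     constants. *)
  rewrite !ltcE !lecE /= => /andP[/eqP-> c0] /andP[/eqP-> s0].
  move=> /andP[/andP[/eqP-> b0] /andP[_ b1]].
  rewrite (scalarE c) => /complex_mx_eq[cE imE] sE angle.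
  exists c, s, b; split=> [|//|i|i j ij]; first by rewrite subr_gt0.
    by have := sE i; rewrite dotE => -[].
  have := angle i j ij; rewrite dotE -add_Re2_Im2 /=.
  rewrite !complexr0 -rmorphXn -rmorphM.
  exact: complexI.
move=> [c [s [b [[c0 s0 b0 b1] [cE imE] sE angle]]]].
exists c%:C, s%:C, b%:C; split.
- by rewrite !ltcE !lecE /= !eqxx c0 s0 b0 -subr_gt0.
- by rewrite scalarE cE imE.
- by move=> i; rewrite dotE sE im0.
- move=> i j ij; rewrite dotE -add_Re2_Im2 /= angle //.
  by rewrite rmorphM rmorphXn.
Qed.

Lemma algebraic_number_complex (R : realType) (x y : R) :
  algebraic_real x -> algebraic_real y -> algebraic_number (x +i* y).
Proof.
have algC z : algebraic_real z -> algebraicOver (ratr : rat -> R[i]) z%:C.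
  case=> p p0 pz; exists p => //.
  have -> : map_poly (ratr : rat -> R[i]) p =
      map_poly (real_complex R) (map_poly ratr p).
    rewrite -map_poly_comp; apply: eq_map_poly => q /=.
    by rewrite fmorph_rat.
  exact: rmorph_root.
move=> xalg yalg; rewrite /algebraic_number [_ +i* _]complexE.
apply: algebraic_add; first exact: algC.
apply: algebraic_mul; last exact: algC.
exists ('X^2 + 1); first by rewrite -size_poly_gt0 size_polyDl ?size_polyXn ?size_poly1.
by rewrite rmorphD rmorph1 /= map_polyXn rootE !hornerE sqr_i addNr.
Qed.

End ComplexMatrices.

(** * Transfer of the ETF system from one evaluation to another *)

Lemma map_mx_surj (A R : nzRingType) (phi : A -> R) (m p : nat)
    (X : 'M[R]_(m, p)) :
  (forall i j, exists a, phi a = X i j) -> exists Xa, map_mx phi Xa = X.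
Proof.
move=> phiX.
have /fin_all_exists[F FE] : forall ij : 'I_m * 'I_p, exists a, phi a = X ij.1 ij.2.
  by move=> ij.
exists (\matrix_(i, j) F (i, j)); apply/matrixP => i j.
by rewrite !mxE FE.
Qed.

Lemma map_gram_re (A R : comNzRingType) (phi : {rmorphism A -> R}) (m p : nat)
    (X Y : 'M[A]_(m, p)) :
  gram_re (map_mx phi X) (map_mx phi Y) = map_mx phi (gram_re X Y).
Proof. by rewrite /gram_re map_mxD !map_mxM !map_trmx. Qed.

Lemma map_gram_im (A R : comNzRingType) (phi : {rmorphism A -> R}) (m p : nat)
    (X Y : 'M[A]_(m, p)) :
  gram_im (map_mx phi X) (map_mx phi Y) = map_mx phi (gram_im X Y).
Proof. by rewrite /gram_im map_mxB !map_mxM !map_trmx. Qed.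

(** An equation says that a difference has sign [0], so [fs] consists of these differences, taken in
    [A], and of the four elements whose signs are prescribed. *)
Lemma real_ETF_transfer (R : realDomainType) (A : comNzRingType) (d n : nat)
    (X Y : 'M[A]_(d, n)) (c s b : A) :
  exists fs : seq A, forall phi psi : {rmorphism A -> R},
    (forall f, f \in fs -> Num.sg (psi f) = Num.sg (phi f)) ->
    real_ETF (map_mx phi X) (map_mx phi Y) (phi c) (phi s) (phi b) ->
    real_ETF (map_mx psi X) (map_mx psi Y) (psi c) (psi s) (psi b).
Proof.
pose tight ij := (gram_re X Y - c%:M) ij.1 ij.2.
pose tight' ij := gram_im X Y ij.1 ij.2.
pose norms i := gram_re X^T Y^T i i - s.
pose angles ij := gram_re X^T Y^T ij.1 ij.2 ^+ 2
  + gram_im X^T Y^T ij.1 ij.2 ^+ 2 - b * s ^+ 2.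
exists ([:: c; s; b; 1 - b] ++ codom tight ++ codom tight' ++ codom norms
  ++ codom angles) => phi psi sgE.
have pos f : f \in [:: c; s; b; 1 - b] -> (0 < phi f -> 0 < psi f) /\
    (0 <= phi f -> 0 <= psi f).
  by move=> fin; rewrite -(sgr_gt0 (phi f)) -(sgr_gt0 (psi f)) -(sgr_ge0 (phi f))
    -(sgr_ge0 (psi f)) sgE // mem_cat fin.
have zero (I : finType) (F : I -> A) k : {subset codom F <= codom tight ++
    codom tight' ++ codom norms ++ codom angles} -> phi (F k) = 0 -> psi (F k) = 0.
  move=> Fin f0; apply/eqP; rewrite -sgr_eq0 sgE ?f0 ?sgr0 //.
  by rewrite mem_cat Fin ?codom_f ?orbT.
have {zero}[tight0 tight'0 norms0 angles0] : [/\
    forall k, phi (tight k) = 0 -> psi (tight k) = 0,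
    forall k, phi (tight' k) = 0 -> psi (tight' k) = 0,
    forall k, phi (norms k) = 0 -> psi (norms k) = 0
  & forall k, phi (angles k) = 0 -> psi (angles k) = 0].
  by split=> k; apply: zero => f Ff; rewrite !mem_cat Ff ?orbT.
have mapE (chi : {rmorphism A -> R}) p q (M : 'M[A]_(p, q)) i j :
    map_mx chi M i j = chi (M i j) by rewrite mxE.
rewrite /real_ETF !map_trmx !map_gram_re !map_gram_im.
move=> [[c0 s0 b0 b1] [cE imE] sE angle]; split.
- split; [apply: (proj1 (pos c _)) c0 | apply: (proj1 (pos s _)) s0
         | apply: (proj2 (pos b _)) b0 | ]; rewrite ?inE ?eqxx ?orbT //.
  rewrite -(rmorph1 psi) -rmorphB; apply: (proj1 (pos (1 - b) _)).
    by rewrite !inE eqxx !orbT.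
  by rewrite rmorphB rmorph1.
- split; apply/matrixP => i j.
    have tightE (chi : {rmorphism A -> R}) :
        chi (tight (i, j)) = map_mx chi (gram_re X Y) i j - (chi c)%:M i j.
      by rewrite -map_scalar_mx !mapE -rmorphB /tight !mxE.
    apply/eqP; rewrite -subr_eq0 -tightE; apply/eqP/tight0.
    by rewrite tightE cE subrr.
  have /matrixP/(_ i j) := imE; rewrite !mapE ![(0 : 'M_d) i j]mxE.
  exact: (tight'0 (i, j)).
- move=> i; have := sE i; rewrite !mapE => si.
  by apply/eqP; rewrite -subr_eq0 -rmorphB norms0 // rmorphB si subrr.
- have anglesE (chi : {rmorphism A -> R}) i j : chi (angles (i, j)) =
      chi (gram_re X^T Y^T i j) ^+ 2 + chi (gram_im X^T Y^T i j) ^+ 2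
      - chi b * chi s ^+ 2.
    by rewrite /angles rmorphB rmorphD !rmorphXn rmorphM rmorphXn.
  move=> i j ij; have := angle i j ij; rewrite !mapE => aij.
  by apply/eqP; rewrite -subr_eq0 -anglesE angles0 // anglesE aij subrr.
Qed.

Theorem theorem7p3 (R : realType) (d n : nat) :
  (exists Phi : 'M[R[i]]_(d, n), is_ETF Phi) ->
  exists Phi : 'M[R[i]]_(d, n),
    is_ETF Phi /\
    forall (i : 'I_d) (j : 'I_n), algebraic_number (Phi i j).
Proof.
move=> [Phi]; rewrite (complex_mxE Phi).
(* The rightmost pattern is generalized first, so [X] holds the real parts and [Y] the imaginary
   parts. *)
move: (map_mx _ Phi) (map_mx _ Phi) => Y X /is_ETF_complex_mx[c [s [b etf]]].
pose coord (Z : 'M[R]_(d, n)) := codom (fun ij : 'I_d * 'I_n => Z ij.1 ij.2).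
(* The constants are made values of [phi] along with the coordinates, since they move with them. *)
have [A [phi [phi_appr phiE]]] :=
  approximable_values ([:: c; s; b] ++ coord X ++ coord Y).
have coordP (Z : 'M[R]_(d, n)) i j : Z i j \in coord Z.
  exact: (codom_f (fun ij : 'I_d * 'I_n => Z ij.1 ij.2) (i, j)).
have [Xa XaE] : exists Xa, map_mx phi Xa = X.
  by apply: map_mx_surj => i j; apply: phiE; rewrite !mem_cat coordP orbT.
have [Ya YaE] : exists Ya, map_mx phi Ya = Y.
  by apply: map_mx_surj => i j; apply: phiE; rewrite !mem_cat coordP !orbT.
have [|ca caE] := phiE c; first by rewrite !inE eqxx.
have [|sa saE] := phiE s; first by rewrite !inE eqxx ?orbT.
have [|ba baE] := phiE b; first by rewrite !inE eqxx ?orbT.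
have [fs fsP] := real_ETF_transfer R Xa Ya ca sa ba.
have [psi psi_alg sgE] := approximable_sgr fs phi_appr.
exists (complex_mx (map_mx psi Xa) (map_mx psi Ya)); split.
  apply/is_ETF_complex_mx; exists (psi ca), (psi sa), (psi ba).
  by apply: fsP sgE _; rewrite XaE YaE caE saE baE.
by move=> i j; rewrite !mxE; apply: algebraic_number_complex.
Qed.
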